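(* Let $m,n$ be positive integers with $m$ even. Then $$\zeta^\star(\{2m\}^n)=(2\pi)^{2mn}\sum_{\substack{p_1+\cdots+p_m=mn\\ p_j\geq0}}\left(\prod_{j=1}^m\frac{B_{2p_j}(\frac12)}{(2p_j)!}\right)\exp\left(\frac{2\pi i}{m}\sum_{\ell=1}^m(\ell-1)p_\ell\right).$$
   Context: $\zeta^\star(\{2m\}^n)=\sum_{1\leq k_1\leq\cdots\leq k_n}(k_1\cdots k_n)^{-2m}$ (multiple zeta-star value with $n$ arguments equal to $2m$). The Bernoulli polynomials $B_n(x)$ are defined by $\frac{te^{xt}}{e^t-1}=\sum_{n\geq0}B_n(x)\frac{t^n}{n!}$. *)

(* Defs.v *)
From HB Require Import structures.
From mathcomp Require Import all_boot all_order all_algebra.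
From mathcomp Require Import complex.
From mathcomp Require Import all_classical all_reals all_analysis.
From mathcomp Require Import ring lra.

Set Implicit Arguments.
Unset Strict Implicit.
Unset Printing Implicit Defensive.

Import Order.TTheory GRing.Theory Num.Theory.
Import numFieldNormedType.Exports.

Local Open Scope classical_set_scope.
Local Open Scope ring_scope.

(* The generating identity sum_n B_n(x) t^n / n! = t e^(xt) / (e^t - 1), for
   real t != 0 close to 0; such an identity determines every B_n(x).  The
   lemmas up to bernoulli_gf_ex only serve to show that some B satisfies it. *)
Definition bernoulli_gf (R : realType) (B : nat -> {poly R}) : Prop :=
  forall x : R, \forall t \near (0 : R)^',
    pseries (fun n => (B n).[x] / n`!%:R) t @ \oo -->
      t * expR (x * t) / (expR t - 1).

Section Existence.
Variable R : realType.

Lemma cauchy_geometric (M r : R) (a c : nat -> R) (A C : R) :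
  0 <= r -> r < 2^-1 ->
  (forall n, `|a n| <= M * r ^+ n) -> (forall n, `|c n| <= M * r ^+ n) ->
  series a @ \oo --> A -> series c @ \oo --> C ->
  series (fun n => \sum_(i < n.+1) a i * c (n - i)%N) @ \oo --> A * C.
Proof.
move=> r0 r2 ha hc cA cC.
set P := series (fun n => _).
have PE n : P n = \sum_(i < n) a i * series c (n - i)%N.
  elim: n => [|n IH]; first by rewrite /P /series/= big_geq // big_ord0.
  rewrite /P seriesSr -/P IH.
  rewrite [RHS](eq_bigr (fun i : 'I_n.+1 => a i * series c (n - i)%N + a i * c (n - i)%N)).
    rewrite big_split /=; congr (_ + _).
    by rewrite big_ord_recr /= subnn /series/= [X in _ * X]big_geq// mulr0 addr0.
  by move=> [i i_n] _ /=; rewrite subSn// seriesSr mulrDr.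
have M0 : 0 <= M by have := ha 0%N; rewrite expr0 mulr1; apply: le_trans.
have tail n i : (i <= n)%N -> `|series c n - series c (n - i)%N| <= 2 * M * r ^+ (n - i).
  move=> lein; set k := (n - i)%N.
  have kn : (k <= n)%N by rewrite leq_subr.
  rewrite sub_series kn.
  apply: (le_trans (ler_norm_sum _ _ _)).
  have H : forall m, \sum_(k <= j < k + m) `|c j| <= 2 * M * r^+k * (1 - r ^+ m).
    elim=> [|m IH]; first by rewrite addn0 big_geq// expr0 subrr mulr0.
    rewrite addnS big_nat_recr ?leq_addr//=.
    apply: (le_trans (lerD IH (hc _))).
    rewrite exprD exprS.
    have h1 : 0 <= r ^+ k by rewrite exprn_ge0.
    have h2 : 0 <= r ^+ m by rewrite exprn_ge0.
    have h3 : 0 <= M * r ^+ k * r ^+ m by rewrite !mulr_ge0.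
    have h4 : 0 <= M * r ^+ k * r ^+ m * (1 - 2 * r) by rewrite mulr_ge0//; lra.
    set u := r ^+ k in h1 h2 h3 h4 *; set v := r ^+ m in h1 h2 h3 h4 *.
    by rewrite -subr_ge0; apply: le_trans h4 _; rewrite le_eqVlt; apply/orP; left; apply/eqP; ring.
  have := H (n - k)%N; rewrite subnKC// => /le_trans; apply.
  rewrite ler_piMr// ?mulr_ge0 ?exprn_ge0//.
  by rewrite gerBl exprn_ge0.
have main : (fun n => series a n * series c n - P n) @ \oo --> 0.
  apply/norm_cvg0P.
  apply: (@squeeze_cvgr _ _ _ _ (fun=> 0) (fun n => 2 * M * M * (2 * r) ^+ n)).
  - near=> n; rewrite normr_ge0/= PE /series/= big_mkord mulr_suml -sumrB.
    apply: (le_trans (ler_norm_sum _ _ _)).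
    apply: (@le_trans _ _ (\sum_(i < n) 2 * M * M * r ^+ n)).
      apply: ler_sum => i _; rewrite -mulrBr normrM.
      apply: (le_trans (ler_pM (normr_ge0 _) (normr_ge0 _) (ha i) (tail n i (ltnW (ltn_ord i))))).
      have -> : r ^+ n = r ^+ i * r ^+ (n - i) by rewrite -exprD subnKC// ltnW.
      by rewrite le_eqVlt; apply/orP; left; apply/eqP; ring.
    rewrite sumr_const card_ord -[leLHS]mulr_natr exprMn -[leLHS]mulrA ler_wpM2l ?mulr_ge0//.
    rewrite mulrC ler_wpM2r ?exprn_ge0// -natrX ler_nat.
    by rewrite ltnW// ltn_expl.
  - exact: cvg_cst.
  - rewrite -[X in _ --> X](mulr0 (2 * M * M)).
    apply: cvgMr; apply: cvg_expr; rewrite ger0_norm; lra.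
have -> : P = (fun n => series a n * series c n - (series a n * series c n - P n)).
  by apply/funext => n; rewrite subKr.
rewrite -[X in _ --> X]subr0.
by apply: cvgB => //; apply: cvgM.
Unshelve. all: by end_near. Qed.

(* Taylor coefficients of t / (e^t - 1). *)
Fixpoint bcoef_upto (n k : nat) : R :=
  if n is n'.+1 then
    if (k <= n')%N then bcoef_upto n' k
    else - \sum_(j < k) bcoef_upto n' j / (k - j).+1`!%:R
  else 1.
Definition bcoef n := bcoef_upto n n.

Lemma bcoef_uptoE n k : (k <= n)%N -> bcoef_upto n k = bcoef k.
Proof.
elim: n => [|n IH]; first by rewrite leqn0 => /eqP ->.
rewrite leq_eqVlt => /orP[/eqP -> //|]; rewrite ltnS => kn.
by rewrite /= kn IH.
Qed.

Lemma bcoefS n : bcoef n.+1 = - \sum_(j < n.+1) bcoef j / (n.+1 - j).+1`!%:R.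
Proof.
rewrite /bcoef/= ltnn; congr (- _); apply: eq_bigr => j _.
by rewrite bcoef_uptoE// -ltnS.
Qed.

Lemma bcoef_conv n :
  \sum_(j < n.+1) bcoef j / (n - j).+1`!%:R = (n == 0)%:R :> R.
Proof.
case: n => [|n]; first by rewrite big_ord1 /bcoef/= divr1.
rewrite big_ord_recr /= subnn bcoefS factS fact0 muln1.
by rewrite divr1 addrC addNr.
Qed.

Lemma fact_ge2 n : (2 ^ n <= (n.+1)`!)%N.
Proof.
by elim: n => // n IH; rewrite factS expnS leq_mul.
Qed.

Lemma bcoef_le1 n : `|bcoef n| <= 1.
Proof.
elim/ltn_ind: n => -[|n] IH; first by rewrite /bcoef/= normr1.
rewrite bcoefS normrN; apply: (le_trans (ler_norm_sum _ _ _)).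
apply: (@le_trans _ _ (\sum_(j < n.+1) 2^-1 ^+ (n.+1 - j))).
  apply: ler_sum => j _; rewrite normrM.
  rewrite -[leRHS]mul1r; apply: ler_pM => //; first exact: IH.
  rewrite ger0_norm ?invr_ge0 ?ler0n// exprVn -natrX lef_pV2 ?posrE ?ltr0n ?fact_gt0 ?expn_gt0//.
  by rewrite ler_nat fact_ge2.
suff -> : \sum_(j < n.+1) 2^-1 ^+ (n.+1 - j) = 1 - 2^-1 ^+ n.+1 :> R.
  by rewrite gerBl exprn_ge0// invr_ge0.
elim: {IH}n => [|n IH]; first by rewrite big_ord1 subn0 expr1; lra.
rewrite big_ord_recl /= subn0.
under eq_bigr => i _ do rewrite /bump/= add1n subSS.
by rewrite IH [in RHS]exprS [in LHS]exprS; lra.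
Qed.

Lemma gf_num_den (t : R) : t != 0 -> `|t| < 2^-1 ->
  series (fun n => bcoef n * t ^+ n) @ \oo --> t / (expR t - 1).
Proof.
move=> t0 t2.
set a := fun n => _.
have ha n : `|a n| <= 1 * `|t| ^+ n.
  by rewrite /a normrM normrX ler_wpM2r ?exprn_ge0 ?bcoef_le1.
have ca : cvgn (series a).
  apply: normed_cvg.
  apply: (@series_le_cvg _ _ (geometric 1 `|t|)); rewrite /=.
  - by move=> n; exact: normr_ge0.
  - by move=> n; rewrite mul1r exprn_ge0.
  - exact: ha.
  by apply: is_cvg_geometric_series; rewrite normr_id; lra.
set c := fun n => t ^+ n / (n.+1)`!%:R : R.
have hc n : `|c n| <= 1 * `|t| ^+ n.
  rewrite mul1r /c normrM normrX ler_piMr ?exprn_ge0//.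
  rewrite ger0_norm ?invr_ge0 ?ler0n// invf_le1 ?ltr0n ?fact_gt0//.
  by rewrite ler1n fact_gt0.
have cc : series c @ \oo --> (expR t - 1) / t.
  have -> : series c = (fun n => (series (exp_coeff t) n.+1 - 1) / t).
    apply/funext => n; rewrite /series/= big_nat_recl//= /exp_coeff/=.
    rewrite expr0 fact0 divr1 addrC addKr mulr_suml.
    by apply: eq_bigr => i _; rewrite /c exprS; field; rewrite t0 pnatr_eq0 -lt0n fact_gt0.
  apply: cvgMl; apply: cvgB; last exact: cvg_cst.
  by rewrite (cvg_shiftS (series (exp_coeff t))); exact: is_cvg_series_exp_coeff.
have := cauchy_geometric (normr_ge0 t) t2 ha hc ca cc.
have -> : (fun n => \sum_(i < n.+1) a i * c (n - i)%N) = (fun n => (n == 0)%:R).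
  apply/funext => n; rewrite (eq_bigr (fun i : 'I_n.+1 => t ^+ n * (bcoef i / (n - i).+1`!%:R))).
    rewrite -mulr_sumr bcoef_conv; case: n => [|n]; first by rewrite mul1r.
    by rewrite mulr0.
  move=> i _; rewrite /a /c.
  have -> : t ^+ n = t ^+ i * t ^+ (n - i) by rewrite -exprD subnKC// leq_ord.
  by rewrite [bcoef i * _]mulrC mulrACA.
move=> h.
have h1 : series (fun n => (n == 0)%:R : R) @ \oo --> (1 : R).
  rewrite -cvg_shiftS.
  have -> : (fun n => series (fun n => (n == 0)%:R : R) n.+1) = fun=> 1.
    by apply/funext => n; rewrite /series/= big_nat_recl//= big1 ?addr0.
  exact: cvg_cst.
have e0 : expR t - 1 != 0.
  apply/eqP => e; move/eqP: e; rewrite subr_eq0 => /eqP e.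
  by move/eqP: t0; apply; apply: expR_inj; rewrite e expR0.
have E : limn (series a) * ((expR t - 1) / t) = 1.
  by apply: cvg_unique h h1; exact: norm_hausdorff.
suff <- : limn (series a) = t / (expR t - 1) by [].
apply: (mulIf (mulf_neq0 e0 (invr_neq0 t0))).
by rewrite E; field; rewrite t0 e0.
Qed.

Definition bernoulli_ex n : {poly R} :=
  n`!%:R *: \sum_(i < n.+1) (bcoef i / (n - i)`!%:R) *: 'X^(n - i).

Lemma bernoulli_gf_ex : exists B, @bernoulli_gf R B.
Proof.
exists bernoulli_ex => x.
near=> t.
have t0 : t != 0 by near: t; exact: nbhs_dnbhs_neq.
have t2 : `|t| < 2^-1.
  near: t; apply: dnbhs0_lt; by rewrite invr_gt0 ltr0n.
have hx : 1 <= expR `|x| by rewrite -expR0 ler_expR.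
set M := expR `|x|.
have ha n : `|bcoef n * t ^+ n| <= M * `|t| ^+ n.
  rewrite normrM normrX ler_wpM2r ?exprn_ge0//.
  by apply: le_trans hx; exact: bcoef_le1.
have hc n : `|exp_coeff (x * t) n| <= M * `|t| ^+ n.
  rewrite /exp_coeff/= exprMn normrM normrM !normrX mulrAC ler_wpM2r ?exprn_ge0//.
  rewrite normfV (@ger0_norm _ n`!%:R)// /M.
  case: n => [|n]; first by rewrite expr0 fact0 divr1.
  have := expR_ge1Dxn n (normr_ge0 x); lra.
have := cauchy_geometric (normr_ge0 t) t2 ha hc (gf_num_den t0 t2)
  (is_cvg_series_exp_coeff (x * t)).
rewrite mulrAC; suff -> : (fun n => \sum_(i < n.+1) bcoef i * t ^+ i * exp_coeff (x * t) (n - i)%N) =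
    (fun i => (bernoulli_ex i).[x] / i`!%:R * t ^+ i) by [].
apply/funext => n; rewrite /bernoulli_ex hornerZ horner_sum [_ * \sum_(_ < _) _]mulrC.
rewrite mulfK ?pnatr_eq0 -?lt0n ?fact_gt0// mulr_suml; apply: eq_bigr => i _.
rewrite hornerZ hornerXn /exp_coeff/= exprMn.
have -> : t ^+ n = t ^+ i * t ^+ (n - i) by rewrite -exprD subnKC// leq_ord.
by set u := (_%:R)^-1; ring.
Unshelve. all: by end_near. Qed.
End Existence.

Definition bernoulli_poly (R : realType) : nat -> {poly R} :=
  projT1 (cid (bernoulli_gf_ex R)).

Lemma bernoulli_polyP (R : realType) : bernoulli_gf (bernoulli_poly R).
Proof. exact: (projT2 (cid (bernoulli_gf_ex R))). Qed.

(* Multiple zeta-star value: sum of prod_i k_i ^ (- s_i) over all integers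
   1 <= k_1 <= ... <= k_n, valued in [0, +oo]. *)
Definition mzsv (R : realType) (n : nat) (s : n.-tuple nat) : \bar R :=
  \esum_(k in [set k : n.-tuple nat | sorted leq k && all (leq 1) k])
    (\prod_(i < n) (tnth k i)%:R ^- tnth s i)%:E.

Definition cexp (R : realType) (z : R[i]) : R[i] :=
  let: (a +i* b)%C := z in ((expR a * cos b) +i* (expR a * sin b))%C.

(* Main.v *)
(* For finitely many x_k the generating series of the complete homogeneous
   symmetric sums h_p is prod_k 1 / (1 - x_k T).  Since
   prod_(j < m) (1 - w^j x T) = 1 - x^m T^m for a primitive m-th root of unity w,
   h_n(x_k^m) is the coefficient of T^(m n) in prod_j sum_p h_p(x_k) (w^j T)^p.
   With x_k = 1/k^2, k <= N, the left side tends to the zeta-star value, so it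
   remains to find lim h_p(1, 1/4, ..., 1/N^2).  By inversion this follows from
   e_i(1, 1/4, ..., 1/N^2) --> pi^(2i) / (2i+1)!, the coefficients of
   sinh(pi z) / (pi z), which are obtained as in Yaglom's proof of
   zeta(2) = pi^2/6: cot^2 t <= 1/t^2 <= 1 + cot^2 t, and the numbers
   cot^2(k pi / (2N+1)) are the roots of an explicit polynomial.  On the other
   side, the generating function at x = 1/2 is (t/2) / sinh(t/2), whose inverse
   has the same coefficients up to powers of 2 pi i; the signs (-1)^(m n)
   disappear because m is even. *)

Require Import Defs.
From HB Require Import structures.
From mathcomp Require Import all_boot all_order all_algebra.
From mathcomp Require Import complex.
From mathcomp Require Import all_classical all_reals all_analysis.
From mathcomp Require Import ring lra zify.

Set Implicit Arguments.
Unset Strict Implicit.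
Unset Printing Implicit Defensive.

Import Order.TTheory GRing.Theory Num.Theory.
Import numFieldNormedType.Exports.

Local Open Scope classical_set_scope.
Local Open Scope ring_scope.

(** * Symmetric functions *)

Section SymmetricFunctions.
Variable A : comNzRingType.
Implicit Types (x y : nat -> A) (N n p i K : nat).

Definition esym x N i := (\prod_(k < N) (1 + x k *: 'X))`_i.

(** The complete homogeneous symmetric sum h_p of x_0, ..., x_(N-1); [i] is the exponent of the last
    variable. *)
Fixpoint hsym x N p : A :=
  if N is N'.+1 then \sum_(i < p.+1) x N' ^+ i * hsym x N' (p - i) else (p == 0)%:R.

Lemma esym0 x N : esym x N 0 = 1.
Proof.
rewrite /esym; elim: N => [|N IH]; first by rewrite big_ord0 coefC.
by rewrite big_ord_recr /= mulrDr mulr1 -scalerAr coefD coefZ coefMX mulr0 addr0.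
Qed.

Lemma esym_ord0 x i : esym x 0 i = (i == 0)%:R.
Proof. by rewrite /esym big_ord0 coefC; case: eqP. Qed.

Lemma esymS x N i : esym x N.+1 i.+1 = esym x N i.+1 + x N * esym x N i.
Proof. by rewrite /esym big_ord_recr /= mulrDr mulr1 -scalerAr coefD coefZ coefMX. Qed.

Lemma esymZ c x N i : esym (fun k => c * x k) N i = c ^+ i * esym x N i.
Proof.
elim: N i => [|N IH] [|i]; rewrite ?esym0 ?expr0 ?mul1r//.
  by rewrite !esym_ord0 mulr0.
by rewrite !esymS !IH exprS; ring.
Qed.

Lemma hsym0 x N : hsym x N 0 = 1.
Proof. by elim: N => [|N IH]//=; rewrite big_ord1 mul1r IH. Qed.

(** A monomial of degree p + 1 either avoids x_N or is x_N times a monomial of degree p. *)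
Lemma hsymS x N p : hsym x N.+1 p.+1 = hsym x N p.+1 + x N * hsym x N.+1 p.
Proof.
rewrite /= big_ord_recl expr0 mul1r subn0 mulr_sumr; congr (_ + _).
by apply: eq_bigr => i _; rewrite /bump/= subSS exprS mulrA.
Qed.

(** The identity H(X) E(-X) = 1 of generating functions, kept within polynomials by truncating H at
    degree K; [q] absorbs the truncation error. *)
Lemma hsym_esym_inv x N K : exists q,
  \poly_(p < K.+1) hsym x N p * \prod_(k < N) (1 - x k *: 'X) = 1 + 'X^(K.+1) * q.
Proof.
elim: N => [|N [q IH]].
  exists 0; rewrite big_ord0 mulr0 addr0 mulr1; apply/polyP => i.
  by rewrite coef_poly coefC /=; case: i => [|i]//=; case: ifP.
exists (q - (x N * hsym x N.+1 K) *: \prod_(k < N) (1 - x k *: 'X)).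
(* By [hsymS] the factor 1 - x_N X removes the last variable, up to one term of degree K + 1 left by
   the truncation. *)
have H : \poly_(p < K.+1) hsym x N.+1 p * (1 - x N *: 'X) =
    \poly_(p < K.+1) hsym x N p - (x N * hsym x N.+1 K) *: 'X^(K.+1).
  apply/polyP => i.
  rewrite mulrBr mulr1 -scalerAr !coefB !coefZ coefMX !coef_poly coefXn.
  case: i => [|i] /=; first by rewrite !(big_ord1, mul1r, mulr0, subr0, expr0).
  rewrite eqSS !ltnS; have [iK|Ki|->] := ltngtP i K.
  - by rewrite mulr0 subr0 -/(hsym x N.+1 i.+1) -/(hsym x N.+1 i) hsymS addrK.
  - by rewrite !mulr0.
  - by rewrite mulr1.
rewrite big_ord_recr /= mulrA -[LHS]mulrA [\prod_(_ < _) _ * _]mulrC mulrA.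
rewrite -/(hsym x N.+1) H mulrBl IH -!scalerAl mulrBr -scalerAr; ring.
Qed.

Lemma sum_esymN_hsym x N p :
  \sum_(i < p.+1) hsym x N i * esym (fun k => - x k) N (p - i) = (p == 0)%:R.
Proof.
have [q] := hsym_esym_inv x N p; move/polyP/(_ p).
rewrite coefD coefC coefXnM ltnSn addr0 coefM.
have -> : (if p == 0 then 1 else 0) = (p == 0)%:R :> A by case: eqP.
move <-; apply: eq_bigr => i _; rewrite coef_poly ltn_ord /esym.
by under [in LHS]eq_bigr do rewrite scaleNr.
Qed.

End SymmetricFunctions.

Lemma rmorph_hsym (A B : comNzRingType) (f : {rmorphism A -> B}) x N p :
  f (hsym x N p) = hsym (f \o x) N p.
Proof.
elim: N p => [|N IH] p /=; first by rewrite rmorph_nat.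
by rewrite rmorph_sum; apply: eq_bigr => i _; rewrite rmorphM rmorphXn IH.
Qed.

(** Factor X^m - 1 at the powers of w^-1, again a primitive root, and write 1 - w^j X = - w^j (X -
    w^-j). *)
Lemma prod_1subX_prim_root (F : fieldType) m (w : F) : m.-primitive_root w ->
  \prod_(j < m) (1 - w ^+ j *: 'X) = 1 - 'X^m :> {poly F}.
Proof.
move=> pw; have m0 := prim_order_gt0 pw.
have w0 : w != 0 by rewrite (prim_root_eq0 pw) -lt0n.
have pw' : m.-primitive_root w^-1.
  have -> : w^-1 = w ^+ m.-1.
    by apply: (mulIf w0); rewrite mulVf// -exprSr prednK// prim_expr_order.
  by rewrite prim_root_exp_coprime// coprimePn.
have := factor_Xn_sub_1 pw'; rewrite big_mkord => E.
have e0 : \prod_(j < m) - (w^-1 ^+ j) = -1.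
  have := congr1 (fun p => p.[0]) E.
  rewrite horner_prod hornerD hornerN hornerXn hornerC expr0n eqn0Ngt m0 /= sub0r => <-.
  by apply: eq_bigr => j _; rewrite hornerXsubC sub0r.
transitivity ((\prod_(j < m) - (w ^+ j))%:P * ('X^m - 1)).
  rewrite -E rmorph_prod -big_split /=; apply: eq_bigr => j _.
  rewrite exprVn mulrBr -polyCM mulNr mulfV ?expf_neq0// !polyCN opprK mulNr mul_polyC.
by rewrite addrC.
(* This product is inverse to the one in [e0], which is the constant term of X^m - 1. *)
have -> : \prod_(j < m) - (w ^+ j) = -1.
  apply: (mulIf (x := \prod_(j < m) - (w^-1 ^+ j))); first by rewrite e0 oppr_eq0 oner_eq0.
  rewrite -big_split /= e0 mulrNN mulr1 big1// => j _.
  by rewrite mulrNN exprVn mulfV// expf_neq0.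
by rewrite polyCN mulN1r opprB.
Qed.

Lemma prod_hsym_prim_root (F : fieldType) m (w : F) (x : nat -> F) N n :
  m.-primitive_root w ->
  hsym (fun k => x k ^+ m) N n =
    \sum_(f : {ffun 'I_m -> 'I_(m * n).+1} | (\sum_(j < m) f j == m * n)%N)
      (\prod_(j < m) hsym x N (f j)) * w ^+ (\sum_(j < m) j * f j).
Proof.
move=> pw; have m0 := prim_order_gt0 pw.
set K := (m * n)%N.
pose H := \poly_(p < K.+1) hsym x N p.
pose E := \prod_(k < N) (1 - x k *: 'X).
pose Hm := \poly_(p < n.+1) hsym (fun k => x k ^+ m) N p.
have [q /= HE] := hsym_esym_inv x N K.
have [r /= GE] := hsym_esym_inv (fun k => x k ^+ m) N n.
rewrite -/H -/E in HE; rewrite -/Hm in GE.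
(* Being 1 modulo X^(K+1) is preserved by products and by the substitution of w^j X. *)
have [q' HE'] : exists q', (\prod_(j < m) (H \Po (w ^+ j *: 'X))) *
   (\prod_(j < m) (E \Po (w ^+ j *: 'X))) = 1 + 'X^(K.+1) * q'.
  rewrite -big_split /=.
  elim/big_ind: _ => [|a b [qa ->] [qb ->]|j _].
  - by exists 0; rewrite mulr0 addr0.
  - exists (qa + qb + 'X^(K.+1) * qa * qb); ring.
  rewrite -comp_polyM HE comp_polyD comp_polyM comp_polyC comp_Xn_poly exprZn.
  by exists ((w ^+ j) ^+ K.+1 *: (q \Po (w ^+ j *: 'X))); rewrite -scalerAl scalerAr.
(* For each k, this is the product over the roots of unity evaluated at x_k X. *)
have EE : \prod_(j < m) (E \Po (w ^+ j *: 'X)) =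
    (\prod_(k < N) (1 - x k ^+ m *: 'X)) \Po 'X^m.
  rewrite [RHS]rmorph_prod.
  transitivity (\prod_(j < m) \prod_(k < N) ((1 - x k *: 'X) \Po (w ^+ j *: 'X))).
    by apply: eq_bigr => j _; rewrite /E rmorph_prod.
  rewrite exchange_big /=; apply: eq_bigr => k _.
  have := congr1 (comp_poly (x k *: 'X)) (prod_1subX_prim_root pw).
  rewrite rmorph_prod /= !(comp_polyB, comp_polyC, comp_polyZ, comp_polyX, comp_Xn_poly).
  rewrite exprZn => <-; apply: eq_bigr => j _.
  rewrite !(comp_polyB, comp_polyC, comp_polyZ, comp_polyX, comp_Xn_poly).
  by rewrite !scalerA mulrC.
have GE' := congr1 (comp_poly 'X^m) GE.
rewrite !(comp_polyD, comp_polyM, comp_polyC, comp_Xn_poly) -EE -exprM in GE'.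
(* Truncating at degree n in X^m is precise enough: the error starts at degree m(n + 1) >= K + 1. *)
have KE : (m * n.+1 = K.+1 + m.-1)%N by rewrite mulnS -/K; lia.
rewrite KE exprD in GE'.
set P := \prod_(j < m) (H \Po _) in HE'.
set Q := \prod_(j < m) (E \Po _) in HE' GE'.
set G := Hm \Po _ in GE'.
(* P and G are both inverse to Q modulo X^(K+1), so they agree up to degree K. *)
have PG : P = G + 'X^(K.+1) * (G * q' - P * ('X^(m.-1) * (r \Po 'X^m))).
  have : P * (G * Q) = G * (P * Q) by ring.
  rewrite HE' GE' => PG; apply/eqP; rewrite -subr_eq0; apply/eqP.
  by move/eqP: PG; rewrite -subr_eq0 => /eqP PG; rewrite -PG; ring.
have -> : hsym (fun k => x k ^+ m) N n = P`_K.
  rewrite PG coefD coefXnM ltnSn addr0 /G /Hm coef_comp_poly_Xn//.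
  by rewrite dvdn_mulr// mulKn// coef_poly ltnSn.
have HX : H = \sum_(p < K.+1) hsym x N p *: 'X^p by exact: poly_def.
have -> : P = \prod_(j < m) \sum_(p < K.+1) (hsym x N p * w ^+ (j * p)) *: 'X^p.
  apply: eq_bigr => j _; rewrite HX rmorph_sum /=; apply: eq_bigr => p _.
  by rewrite comp_polyZ comp_Xn_poly exprZn scalerA -exprM.
rewrite bigA_distr_bigA /= coef_sum [RHS]big_mkcond /=; apply: eq_bigr => f _.
have -> : \prod_(j < m) ((hsym x N (f j) * w ^+ (j * f j)) *: 'X^(f j)) =
    ((\prod_(j < m) hsym x N (f j)) * w ^+ (\sum_(j < m) j * f j)) *:
      'X^(\sum_(j < m) f j).
  rewrite !expr_sum -big_split /= -mul_polyC rmorph_prod -big_split /=.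
  by apply: eq_bigr => j _; rewrite mul_polyC.
by rewrite coefZ coefXn eq_sym; case: eqP => _; rewrite ?mulr0 ?mulr1.
Qed.

(** * The sine product *)

Section Trigonometry.
Variable R : realType.
Implicit Types t : R.

Lemma sin_le t : 0 <= t -> sin t <= t.
Proof.
move=> t0.
have d (x : R) : is_derive x 1 (fun x => x - sin x) (1 - cos x).
  by apply: is_deriveB; exact: is_derive_sin.
have := @ger0_derive1_ndecr R (fun x => x - sin x) 0 t.
move=> /(_ _ _ _ 0 t (lexx _) t0 (lexx _)); rewrite sin0 subrr subr_ge0; apply.
- by move=> x _; apply: ex_derive.
- by move=> x _; rewrite derive1E derive_val subr_ge0 cos_le1.
- apply: derivable_within_continuous => x _; exact: ex_derive.
Qed.

Lemma mulr_cos_le_sin t : 0 <= t <= pi -> t * cos t <= sin t.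
Proof.
move=> /andP[t0 tpi].
have d (x : R) : is_derive x 1 (fun x => sin x - x * cos x) (x * sin x).
  apply: is_derive_eq (is_deriveB (is_derive_sin x)
    (is_deriveM (is_derive_id x 1) (is_derive_cos x))) _.
  by rewrite /GRing.scale/=; ring.
have := @ger0_derive1_ndecr R (fun x => sin x - x * cos x) 0 t.
move=> /(_ _ _ _ 0 t (lexx _) t0 (lexx _)); rewrite sin0 mul0r subrr subr_ge0; apply.
- by move=> x _; apply: ex_derive.
- move=> x /[!in_itv]/= /andP[x0 xt]; rewrite derive1E derive_val mulr_ge0 ?ltW//.
  by apply: sin_gt0_pi; rewrite x0 (lt_le_trans xt).
- apply: derivable_within_continuous => x _; exact: ex_derive.
Qed.

(** Invert and square t cos t <= sin t <= t, using 1 / sin^2 = 1 + cot^2. *)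
Lemma cot2_bounds t : 0 < t < pi / 2 ->
  (tan t)^-1 ^+ 2 <= t^-1 ^+ 2 <= 1 + (tan t)^-1 ^+ 2.
Proof.
move=> /andP[t0 tpi].
have pi0 := pi_gt0 R.
have s0 : 0 < sin t by apply: sin_gt0_pihalf; rewrite t0.
have c0 : 0 < cos t by apply: cos_gt0_pihalf; rewrite tpi andbT; lra.
have ti0 : 0 <= t^-1 by rewrite invr_ge0 ltW.
have si0 : 0 <= (sin t)^-1 by rewrite invr_ge0 ltW.
have ct0 : 0 <= cos t / sin t by rewrite mulr_ge0// ltW.
have st := sin_le (ltW t0).
have ct : t * cos t <= sin t by apply: mulr_cos_le_sin; lra.
rewrite /tan invf_div; apply/andP; split.
  rewrite ler_pXn2r ?nnegrE//.
  by rewrite ler_pdivrMr// ler_pdivlMl.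
have -> : 1 + (cos t / sin t) ^+ 2 = (sin t)^-1 ^+ 2.
  rewrite expr_div_n exprVn -[X in X + _](divff (_ : sin t ^+ 2 != 0)) ?expf_neq0 ?gt_eqF//.
  by rewrite -mulrDl addrC cos2Dsin2 mul1r.
by rewrite ler_pXn2r ?nnegrE// lef_pV2.
Qed.

Definition cis t : R[i] := (cos t +i* sin t)%C.

Lemma moivre t n : cis t ^+ n = cis (n%:R * t).
Proof.
elim: n => [|n IH]; first by rewrite /cis expr0 mul0r cos0 sin0.
rewrite exprS IH /cis -natr1 mulrDl mul1r [_ + t]addrC cosD sinD.
by apply/eqP; rewrite eq_complex /=; apply/andP; split; apply/eqP; ring.
Qed.

(** The imaginary part of (cos t + i sin t)^(2N+1), to which only the odd powers of i sin t
    contribute. *)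
Lemma sin_mulrn_odd t N :
  sin ((N.*2.+1)%:R * t) =
  \sum_(j < N.+1) (-1) ^+ j * 'C(N.*2.+1, j.*2.+1)%:R *
                  cos t ^+ (N - j).*2 * sin t ^+ j.*2.+1.
Proof.
have E (s : nat -> R) : \sum_(k < N.*2.+2) s k =
    \sum_(j < N.+1) s j.*2 + \sum_(j < N.+1) s j.*2.+1.
  elim: N => [|N' IH]; first by rewrite !big_ord_recr !big_ord0 /=; ring.
  rewrite doubleS big_ord_recr big_ord_recr /= IH [in RHS]big_ord_recr /=.
  by rewrite [X in _ = _ + X]big_ord_recr /=; ring.
have -> : sin ((N.*2.+1)%:R * t) = complex.Im (cis t ^+ N.*2.+1).
  by rewrite moivre.
have -> : cis t = (cos t)%:C%C + (sin t)%:C%C * 'i%C.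
  by apply/eqP; rewrite eq_complex /=; apply/andP; split; apply/eqP; ring.
have i2 (j : nat) : 'i%C ^+ j.*2 = ((-1) ^+ j)%:C%C :> R[i].
  by rewrite -muln2 mulnC exprM sqr_i rmorphXn rmorphN1.
rewrite exprDn raddf_sum /=.
rewrite (E (fun k => complex.Im
  (((cos t)%:C%C ^+ (N.*2.+1 - k) * ((sin t)%:C%C * 'i%C) ^+ k) *+ 'C(N.*2.+1, k)))).
rewrite big1 ?add0r => [|j _].
  apply: eq_bigr => -[j jN] _ /=.
  rewrite subSS -doubleB exprMn [ 'i%C ^+ _]exprS i2 -!rmorphXn /= -mulr_natl.
  by rewrite -(rmorph_nat (real_complex R)) /=; ring.
by rewrite exprMn i2 -!rmorphXn -!rmorphM /= -mulr_natl -(rmorph_nat (real_complex R)) -rmorphM.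
Qed.

End Trigonometry.

Section SineProduct.
Variable R : realType.
Implicit Types (N i : nat).

Definition angle N k : R := k.+1%:R * pi / (N.*2.+1)%:R.

Lemma angle_bounds N k : (k < N)%N -> 0 < angle N k < pi / 2.
Proof.
move=> kN; have p0 := pi_gt0 R; rewrite /angle; apply/andP; split.
  by rewrite divr_gt0 ?mulr_gt0.
have : (k.+1 * 2)%:R < (N.*2.+1)%:R :> R by rewrite ltr_nat; lia.
by rewrite natrM -(ltr_pM2r p0) ltr_pdivrMr//; lra.
Qed.

(** Dividing the expansion of sin((2N+1)t) by cos^(2N) t sin t leaves the left side evaluated at
    tan^2 t. Its N roots are therefore the tan^2 of the N angles, and no others by degree. *)
Lemma prod_cot2 N :
  \poly_(j < N.+1) ((-1) ^+ j * 'C(N.*2.+1, j.*2.+1)%:R) =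
  (N.*2.+1)%:R *: \prod_(k < N) (1 - (tan (angle N k))^-1 ^+ 2 *: 'X).
Proof.
set Q := \poly_(j < _) _.
pose rs := [seq tan (angle N k) ^+ 2 | k <- iota 0 N].
have ab k : k \in iota 0 N -> 0 < angle N k < pi / 2.
  by rewrite mem_iota => /andP[_]; exact: angle_bounds.
have pi0 := pi_gt0 R.
have t0 k : k \in iota 0 N -> 0 < tan (angle N k).
  move=> /ab h; rewrite divr_gt0 ?sin_gt0_pihalf ?cos_gt0_pihalf//.
  by move: h => /andP[h ->]; rewrite andbT; lra.
have sQ : size Q = (size rs).+1.
  rewrite size_map size_iota size_poly_eq//.
  by rewrite mulf_neq0 ?signr_eq0// pnatr_eq0 -lt0n bin_gt0.
have rQ : all (root Q) rs.
  apply/allP => _ /mapP[k kN ->]; rewrite /root horner_poly.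
  have := sin_mulrn_odd (angle N k) N.
  rewrite /angle [_%:R * (_ / _)]mulrC divfK// -/(angle N k) => E.
  have c0 : 0 < cos (angle N k).
    rewrite cos_gt0_pihalf//; move: (ab _ kN) => /andP[h ->]; rewrite andbT; lra.
  have s0 := sin_gt0_pihalf (ab _ kN).
  have sk : sin (k.+1%:R * pi) = 0 :> R.
    elim: (k.+1) => [|j IH]; first by rewrite mul0r sin0.
    by rewrite -natr1 mulrDl mul1r sinDpi IH oppr0.
  have H : \sum_(i < N.+1) (-1) ^+ i * 'C(N.*2.+1, i.*2.+1)%:R *
      (tan (angle N k) ^+ 2) ^+ i * (cos (angle N k) ^+ N.*2 * sin (angle N k)) = 0.
    rewrite -[RHS]sk E; apply: eq_bigr => -[i iN] _ /=.
    rewrite -!mulrA; congr (_ * (_ * _)); rewrite -exprM mul2n /tan.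
    rewrite expr_div_n exprS doubleB.
    have -> : cos (angle N k) ^+ N.*2 =
       cos (angle N k) ^+ (N.*2 - i.*2) * cos (angle N k) ^+ i.*2.
      by rewrite -exprD subnK// leq_double.
    by field; rewrite expf_neq0 ?gt_eqF.
  move/eqP: H; rewrite -mulr_suml mulf_eq0 => /orP[//|].
  by rewrite mulf_eq0 expf_eq0 (gt_eqF c0) (gt_eqF s0) andbF.
(* The tangents are positive, so their squares are distinct because [tan] is injective on the
   interval from -pi/2 to pi/2. *)
have uQ : uniq_roots rs.
  rewrite uniq_rootsE map_inj_in_uniq ?iota_uniq// => k l kN lN.
  move=> /eqP; rewrite eqrXn2 ?ltW ?t0// => /eqP /tan_inj.
  rewrite !in_itv /=.
  have /andP[h1 h2] := ab _ kN; have /andP[h3 h4] := ab _ lN.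
  have -> : - (pi / 2) < angle N k < pi / 2 by rewrite h2 andbT; lra.
  have -> : - (pi / 2) < angle N l < pi / 2 by rewrite h4 andbT; lra.
  move=> /(_ isT isT); rewrite /angle => /(mulIf _) /(mulIf _).
  rewrite invr_eq0 pnatr_eq0 gt_eqF// => /(_ isT isT) /eqP.
  by rewrite eqr_nat eqSS => /eqP.
have EQ := all_roots_prod_XsubC sQ rQ uQ.
pose c := \prod_(z <- rs) - z.
have Epr : \prod_(z <- rs) ('X - z%:P) =
    c *: \prod_(k < N) (1 - (tan (angle N k))^-1 ^+ 2 *: 'X).
  rewrite -mul_polyC /c /rs !big_map -[in iota 0 N](subn0 N) !big_mkord.
  rewrite rmorph_prod -big_split /=; apply: eq_bigr => -[k kN] _ /=.
  have t0' := t0 k; rewrite mem_iota kN in t0'.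
  rewrite mul_polyC scalerBr scalerA mulNr -exprMn divff ?gt_eqF ?t0'//.
  by rewrite expr1n scaleN1r opprK alg_polyC polyCN addrC.
rewrite {}Epr scalerA in EQ; rewrite EQ; congr (_ *: _).
(* The scalar is the value at 0, the binomial coefficient of 2N+1 over 1. *)
have := congr1 (fun p => p.[0]) EQ.
rewrite hornerZ horner_prod big1 => [|k _].
  by rewrite mulr1 horner_coef0 coef_poly /= expr0 mul1r bin1 => <-.
by rewrite !hornerE subr0.
Qed.
End SineProduct.

(** * Symmetric functions of inverse squares *)

Section EsymLimit.
Variable R : realType.
Implicit Types (x y : nat -> R) (N i : nat).

Lemma esym_ge0 x N i : (forall k, (k < N)%N -> 0 <= x k) -> 0 <= esym x N i.
Proof.
elim: N i => [|N IH] [|i] x0; rewrite ?esym0// ?esym_ord0//.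
have x0' k : (k < N)%N -> 0 <= x k by move=> /ltnW; exact: x0.
by rewrite esymS addr_ge0 ?mulr_ge0 ?IH// x0.
Qed.

(** Every monomial of e_i occurs in the expansion of the i-th power of the sum. *)
Lemma esym_le_sum x N i : (forall k, (k < N)%N -> 0 <= x k) ->
  esym x N i <= (\sum_(k < N) x k) ^+ i.
Proof.
elim: N i => [|N IH] [|i] x0; rewrite ?esym0 ?expr0//.
  by rewrite esym_ord0 big_ord0 expr0n.
have x0' k : (k < N)%N -> 0 <= x k by move=> /ltnW; exact: x0.
have S0 : 0 <= \sum_(k < N) x k by apply: sumr_ge0 => k _; exact: x0'.
have xN := x0 N (ltnSn _).
rewrite esymS big_ord_recr /=; set S := \sum_(k < N) _ in IH S0 *.
apply: (@le_trans _ _ (S ^+ i * (S + x N))).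
  have h1 := IH i.+1 x0'; have h2 := ler_wpM2l xN (IH i x0').
  by rewrite exprS in h1; rewrite mulrDr; lra.
rewrite exprSr ler_wpM2r ?addr_ge0// lerXn2r ?nnegrE ?addr_ge0//.
by rewrite lerDl.
Qed.

(** Changing one variable by at most e changes e_(i+1) by at most e times an e_i in the others;
    there are N variables. *)
Lemma esym_sub_bound x y (e : R) N i : 0 <= e ->
  (forall k, (k < N)%N -> 0 <= y k <= x k) ->
  (forall k, (k < N)%N -> x k <= y k + e) ->
  0 <= esym x N i.+1 - esym y N i.+1 <= N%:R * e * esym x N i.
Proof.
move=> e0; elim: N i => [|N IH] i yx xy.
  by rewrite !esym_ord0 subrr mul0r mul0r lexx.
have yx' k : (k < N)%N -> 0 <= y k <= x k by move=> /ltnW; exact: yx.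
have xy' k : (k < N)%N -> x k <= y k + e by move=> /ltnW; exact: xy.
have y0 j : 0 <= esym y N j by apply: esym_ge0 => k /yx' /andP[].
have x0 j : 0 <= esym x N j.
  by apply: esym_ge0 => k /yx' /andP[]; exact: le_trans.
have /andP[yN yxN] := yx N (ltnSn _); have xyN := xy N (ltnSn _).
have lexy j : esym y N j <= esym x N j.
  by case: j => [|j]; rewrite ?esym0// -subr_ge0; have /andP[] := IH j yx' xy'.
have /andP[h1 h2] := IH i yx' xy'.
have -> : esym x N.+1 i.+1 - esym y N.+1 i.+1 =
    (esym x N i.+1 - esym y N i.+1) + x N * (esym x N i - esym y N i)
    + (x N - y N) * esym y N i by rewrite !esymS; ring.
have h3 : 0 <= x N * (esym x N i - esym y N i).
  by rewrite mulr_ge0 ?subr_ge0// (le_trans yN).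
have h4 : 0 <= (x N - y N) * esym y N i by rewrite mulr_ge0 ?subr_ge0.
have h5 : (x N - y N) * esym y N i <= e * esym x N i.
  by apply: ler_pM; rewrite ?subr_ge0//; lra.
apply/andP; split; first by rewrite addr_ge0// addr_ge0.
case: i => [|i] in h1 h2 h3 h4 h5 *.
  by rewrite !esym0 in h2 h3 h4 h5 *; rewrite -natr1; lra.
have /andP[h6 h7] := IH i yx' xy'.
have h8 : x N * (esym x N i.+1 - esym y N i.+1) <= x N * (N%:R * e * esym x N i).
  by rewrite ler_wpM2l// (le_trans yN).
rewrite esymS -natr1.
have h9 : 0 <= e * (x N * esym x N i) by rewrite !mulr_ge0// (le_trans yN).
have -> : (N%:R + 1) * e * (esym x N i.+1 + x N * esym x N i) =
  N%:R * e * esym x N i.+1 + x N * (N%:R * e * esym x N i)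
  + e * esym x N i.+1 + e * (x N * esym x N i) by ring.
lra.
Qed.

Definition inv_sq k : R := k.+1%:R^-1 ^+ 2.

Lemma inv_sq_ge0 k : 0 <= inv_sq k.
Proof. by rewrite /inv_sq exprn_ge0. Qed.

Lemma sum_inv_sq_le2 N : \sum_(k < N) inv_sq k <= 2.
Proof.
(* The sharper bound makes the induction work, as 1/(k+1)^2 <= 1/k - 1/(k+1). *)
suff : \sum_(k < N.+1) inv_sq k <= 2 - N.+1%:R^-1.
  rewrite big_ord_recr /= => h; apply: (le_trans _ (le_trans h _)).
    by rewrite lerDl inv_sq_ge0.
  by rewrite gerBl.
elim: N => [|N IH]; first by rewrite big_ord1 /inv_sq invr1 expr1n; lra.
rewrite big_ord_recr /=; apply: (le_trans (lerD IH (lexx _))).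
rewrite /inv_sq; set a : R := N.+1%:R; have -> : N.+2%:R = a + 1 :> R by rewrite natr1.
have a0 : 0 < a by rewrite /a.
rewrite -subr_ge0.
have -> : 2 - (a + 1)^-1 - (2 - a^-1 + (a + 1)^-1 ^+ 2) = (a * (a + 1) ^+ 2)^-1.
  by field; rewrite !gt_eqF//; lra.
by rewrite invr_ge0 mulr_ge0 ?exprn_ge0//; lra.
Qed.

Let n_ N : R := (N.*2.+1)%:R.

Lemma cvg_inv_odd : (fun N => (n_ N)^-1) @ \oo --> (0 : R).
Proof.
apply: (@squeeze_cvgr _ _ _ _ (fun=> 0) (@harmonic R)).
- near=> N; rewrite invr_ge0 ler0n/= lef_pV2 ?posrE ?ltr0n//.
  by rewrite ler_nat ltnS -addnn leq_addr.
- exact: cvg_cst.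
- exact: cvg_harmonic.
Unshelve. all: by end_near. Qed.

Lemma cvg_ffact_odd i : (fun N => (N.*2.+1 ^_ i)%:R / n_ N ^+ i) @ \oo --> (1 : R).
Proof.
elim: i => [|i IH].
  have -> : (fun N => (N.*2.+1 ^_ 0)%:R / n_ N ^+ 0) = fun=> 1 :> R.
    by apply/funext => N; rewrite ffactn0 expr0 divr1.
  exact: cvg_cst.
have h : (fun N => (N.*2.+1 ^_ i)%:R / n_ N ^+ i * (1 - i%:R * (n_ N)^-1)) @ \oo --> (1 : R).
  rewrite -[X in _ --> X]mulr1; apply: cvgM => //.
  rewrite -[X in _ --> X]subr0; apply: cvgB; first exact: cvg_cst.
  by rewrite -[X in _ --> X](mulr0 i%:R); apply: cvgMr; exact: cvg_inv_odd.
apply: (cvg_trans _ h); apply: near_eq_cvg; near=> N.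
(* This keeps the natural subtraction 2N + 1 - i in the new factor from truncating. *)
have iN : (i <= N)%N by near: N; exact: nbhs_infty_ge.
have n0 : n_ N != 0 by rewrite /n_ pnatr_eq0.
rewrite ffactnSr natrM natrB; last by lia.
rewrite -/(n_ N) exprSr; move: (n_ N) n0 => a a0.
by field; rewrite a0 expf_neq0.
Unshelve. all: by end_near. Qed.

Lemma cvg_esym_inv_sq i :
  (fun N => esym inv_sq N i) @ \oo --> pi ^+ i.*2 / ((i.*2.+1)`!%:R : R).
Proof.
(* The lower bound for [inv_sq k] given by [cot2_bounds], whose middle term is 1/(k+1)^2 once scaled
   by (pi / (2N+1))^2. *)
pose y N k : R := (pi / n_ N) ^+ 2 * (tan (angle R N k))^-1 ^+ 2.
have n0 N : 0 < n_ N by rewrite /n_.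
have pi0 := pi_gt0 R.
have ey N : esym (y N) N i = pi ^+ i.*2 / (i.*2.+1)`!%:R *
    ((N.*2.+1 ^_ i.*2.+1)%:R / n_ N ^+ i.*2.+1).
  rewrite /y esymZ.
  have := congr1 (fun p : {poly R} => (-1) ^+ i * p`_i) (prod_cot2 R N).
  rewrite coefZ coef_poly.
  have -> : (\prod_(k < N) (1 - (tan (angle R N k))^-1 ^+ 2 *: 'X))`_i =
     (-1) ^+ i * esym (fun k => (tan (angle R N k))^-1 ^+ 2) N i.
    rewrite -esymZ /esym; congr (nth _ (polyseq _) _); apply: eq_bigr => k _.
    by rewrite mulN1r scaleNr.
  (* Beyond the degree the binomial coefficient vanishes too. *)
  have -> : (if (i < N.+1)%N then (-1) ^+ i * 'C(N.*2.+1, i.*2.+1)%:R else 0 : R) =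
      (-1) ^+ i * 'C(N.*2.+1, i.*2.+1)%:R.
    by case: ltnP => // Ni; rewrite bin_small ?mulr0//; lia.
  rewrite mulrA -expr2 sqrr_sign mul1r mulrCA [X in _ * X]mulrA.
  rewrite -expr2 sqrr_sign mul1r -/(n_ N) => E.
  have -> : esym (fun k => (tan (angle R N k))^-1 ^+ 2) N i = 'C(N.*2.+1, i.*2.+1)%:R / n_ N.
    by rewrite E mulrC mulKf// gt_eqF.
  rewrite -bin_ffact natrM -exprM mul2n expr_div_n exprS.
  by field; rewrite ?expf_neq0 ?gt_eqF//= pnatr_eq0 -lt0n fact_gt0.
have cy : (fun N => esym (y N) N i) @ \oo --> pi ^+ i.*2 / ((i.*2.+1)`!%:R : R).
  rewrite (funext ey).
  by rewrite -[X in _ --> X]mulr1; apply: cvgMr; exact: cvg_ffact_odd.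
case: i => [|i] in ey cy *.
  rewrite (_ : (fun N => _) = (fun N => esym (y N) N 0))//.
  by apply/funext => N; rewrite !esym0.
have xy N k : (k < N)%N -> y N k <= inv_sq k <= y N k + (pi / n_ N) ^+ 2.
  move=> kN; have /andP[h1 h2] := cot2_bounds (angle_bounds R kN).
  have -> : inv_sq k = (pi / n_ N) ^+ 2 * (angle R N k)^-1 ^+ 2.
    rewrite /inv_sq /angle -exprMn; congr (_ ^+ 2).
    have a0 : k.+1%:R != 0 :> R by rewrite pnatr_eq0.
    have b0 : n_ N != 0 by rewrite gt_eqF.
    rewrite -/(n_ N); move: (n_ N) (k.+1%:R : R) a0 b0 => b a a0 b0.
    have p0 : pi != 0 :> R by rewrite gt_eqF.
    by move: (pi : R) p0 => p p0; field; rewrite a0 b0 p0.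
  rewrite /y -[X in _ <= _ + X]mulr1 -mulrDr [_ + 1]addrC.
  by rewrite !ler_pM2l ?exprn_gt0 ?divr_gt0// h1.
(* Each variable is off by at most (pi / (2N+1))^2 and e_i is at most 2^i, so the total error is
   O(1/N). *)
apply: (@squeeze_cvgr _ _ _ _ (fun N => esym (y N) N i.+1)
  (fun N => esym (y N) N i.+1 + pi ^+ 2 * 2 ^+ i * (n_ N)^-1)) => //.
  near=> N.
  have d0 : 0 <= (pi / n_ N) ^+ 2 by rewrite exprn_ge0// divr_ge0 ?ltW.
  have yx k : (k < N)%N -> 0 <= y N k <= inv_sq k.
    by move=> /xy /andP[-> _]; rewrite andbT mulr_ge0// exprn_even_ge0.
  have xy' k : (k < N)%N -> inv_sq k <= y N k + (pi / n_ N) ^+ 2 by move=> /xy /andP[].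
  have := esym_sub_bound i d0 yx xy'.
  move=> /andP[]; rewrite subr_ge0 => -> /= h; rewrite -lerBlDl (le_trans h)//.
  have e2 : esym inv_sq N i <= 2 ^+ i.
    apply: (le_trans (esym_le_sum _ _)) => [k _|]; first exact: inv_sq_ge0.
    rewrite lerXn2r ?nnegrE ?sum_inv_sq_le2//.
    by apply: sumr_ge0 => k _; exact: inv_sq_ge0.
  have e0 : 0 <= esym inv_sq N i by apply: esym_ge0 => k _; exact: inv_sq_ge0.
  have -> : pi ^+ 2 * 2 ^+ i * (n_ N)^-1 = (n_ N * (pi / n_ N) ^+ 2) * 2 ^+ i.
    by field; rewrite gt_eqF.
  apply: ler_pM => //; first by rewrite mulr_ge0// exprn_ge0// divr_ge0 ?ltW.
  by apply: ler_wpM2r; [exact: d0 | rewrite /n_ ler_nat; lia].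
rewrite -[X in _ --> X]addr0; apply: cvgD => //.
by rewrite -[X in _ --> X](mulr0 (pi ^+ 2 * 2 ^+ i)); apply: cvgMr; exact: cvg_inv_odd.
Unshelve. all: by end_near. Qed.

End EsymLimit.

(** * Bernoulli polynomials at 1/2 *)

Section PowerSeries.
Variable R : realType.

(** Once the coefficients below n vanish, the tail bounds |d_n t^n| by a constant times |t|^(n+1);
    divide by |t|^n and let t tend to 0. *)
Lemma power_series_coef_eq0 (d : nat -> R) (M rho : R) : 0 < rho ->
  (forall k, `|d k| <= M * rho ^+ k) ->
  (\forall t \near (0 : R)^', pseries d t @ \oo --> (0 : R)) ->
  forall n, d n = 0.
Proof.
move=> rho0 dM d0; elim/ltn_ind => n IH.
have M0 : 0 <= M by have := dM 0%N; rewrite expr0 mulr1; apply: le_trans.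
apply/eqP; rewrite -normr_le0; apply/ler_addgt0Pr => e e0; rewrite add0r.
near (0 : R)^' => t.
have t0 : t != 0 by near: t; exact: nbhs_dnbhs_neq.
have tp : 0 < `|t| by rewrite normr_gt0.
have ht : `|t| < (2 * rho)^-1.
  by near: t; apply: dnbhs0_lt; rewrite invr_gt0 mulr_gt0.
(* Makes the final bound 2 M rho^(n+1) |t| at most e; the added 1 keeps the denominator positive. *)
have he : `|t| < e / (2 * M * rho ^+ n.+1 + 1).
  near: t; apply: dnbhs0_lt; rewrite divr_gt0// ltr_wpDl//.
  by rewrite !mulr_ge0// exprn_ge0// ltW.
have dt : pseries d t @ \oo --> (0 : R) by near: t.
pose r := rho * `|t|.
have r0 : 0 <= r by rewrite mulr_ge0// ltW.
have r2 : r <= 2^-1.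
  have /ltW : r < rho * (2 * rho)^-1 by rewrite ltr_pM2l.
  by rewrite invfM mulrCA mulfV ?gt_eqF// mulr1.
(* A geometric sum of ratio 1/2, which dominates since r <= 1/2. *)
have tail k : `|\sum_(n.+1 <= j < n.+1 + k) d j * t ^+ j| <=
    2 * M * r ^+ n.+1 * (1 - 2^-1 ^+ k).
  elim: k => [|k IHk]; first by rewrite addn0 big_geq// expr0 subrr mulr0 normr0.
  rewrite addnS big_nat_recr ?leq_addr//=.
  apply: (le_trans (ler_normD _ _)); apply: (le_trans (lerD IHk (lexx _))).
  have : `|d (n.+1 + k)%N * t ^+ (n.+1 + k)| <= M * r ^+ n.+1 * 2^-1 ^+ k.
    rewrite normrM normrX; apply: (le_trans (ler_wpM2r _ (dM _))); first exact: exprn_ge0.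
    rewrite -!mulrA -exprMn -/r exprD !ler_wpM2l ?exprn_ge0//.
    by rewrite lerXn2r// nnegrE invr_ge0.
  rewrite [2^-1 ^+ k.+1]exprS; set u := M * r ^+ n.+1.
  have -> : 2 * M * r ^+ n.+1 = 2 * u by rewrite /u mulrA.
  lra.
have bound : `|d n * t ^+ n| <= 2 * M * r ^+ n.+1.
  have cN : (fun N => pseries d t N - d n * t ^+ n) @ \oo --> - (d n * t ^+ n).
    by rewrite -[X in _ --> X]add0r; apply: cvgB => //; exact: cvg_cst.
  have cn : (fun N => `|pseries d t N - d n * t ^+ n|) @ \oo --> `|d n * t ^+ n|.
    by rewrite -normrN; exact: cvg_norm cN.
  apply: (cvgr_to_le cn).
  near=> N.
  have nN : (n.+1 <= N)%N by near: N; exact: nbhs_infty_ge.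
  rewrite /pseries /series/= (big_cat_nat (n := n.+1))//= big_nat_recr//=.
  rewrite big_nat big1 ?add0r => [|i /andP[_ iN]]; last by rewrite IH// mul0r.
  rewrite [_ + _ - _]addrAC subrr add0r -[in X in \sum_(_ <= _ < X) _](subnKC nN).
  apply: (le_trans (tail _)); rewrite ler_piMr ?gerBl ?exprn_ge0 ?invr_ge0//.
  by rewrite !mulr_ge0// exprn_ge0.
move: bound; rewrite normrM normrX /r exprMn [`|t| ^+ n.+1]exprS.
rewrite !mulrA ler_pM2r ?exprn_gt0// => /le_trans; apply.
move: he; rewrite ltr_pdivlMr; last first.
  by rewrite ltr_wpDl// !mulr_ge0// exprn_ge0// ltW.
by rewrite mulrDr mulr1 mulrC; lra.
Unshelve. all: by end_near. Qed.

Lemma cvg_pseries_coef_bound (c : nat -> R) (t : R) : t != 0 ->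
  cvgn (pseries c t) -> exists M, forall n, `|c n| <= M * `|t|^-1 ^+ n.
Proof.
move=> t0 /cvg_series_bounded [M [_ HM]].
exists (M + 1) => n; have := HM _ (ltr_pwDr ltr01 (lexx M)) n I.
have tp : 0 < `|t| by rewrite normr_gt0.
by rewrite /= normrM normrX exprVn ler_pdivlMr ?exprn_gt0.
Qed.

(* Taylor coefficients of sinh(t/2) / (t/2). *)
Definition sinhc_coef n : R := (2^-1 ^+ n.+1 - (- 2^-1) ^+ n.+1) / (n.+1)`!%:R.

Lemma sinhc_coef_bound n : `|sinhc_coef n| <= 1.
Proof.
rewrite /sinhc_coef normrM normfV ler_pdivrMr ?normr_gt0 ?pnatr_eq0 -?lt0n ?fact_gt0//.
rewrite mul1r [leRHS]ger0_norm//; apply: (@le_trans _ _ 1); last by rewrite ler1n fact_gt0.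
apply: (le_trans (ler_normB _ _)); rewrite !normrX normrN.
have : `|2^-1 : R| ^+ n.+1 <= 2^-1.
  rewrite ger0_norm ?invr_ge0// exprS ler_piMr ?invr_ge0// exprn_ile1 ?invr_ge0//.
  by rewrite invf_le1 ?ler1n.
lra.
Qed.

Lemma cvg_pseries_sinhc (t : R) : t != 0 ->
  pseries sinhc_coef t @ \oo --> (expR (t / 2) - expR (- (t / 2))) / t.
Proof.
move=> t0.
have -> : pseries sinhc_coef t =
    (fun n => (series (exp_coeff (t / 2)) n.+1 - series (exp_coeff (- (t / 2))) n.+1) / t).
  apply/funext => n; rewrite /pseries /series/= -sumrB big_nat_recl//=.
  rewrite /exp_coeff /= !expr0 subrr add0r mulr_suml; apply: eq_bigr => i _.
  rewrite /sinhc_coef -[- (t / 2)]mulrN !exprMn [t ^+ i.+1]exprS.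
  move: (2^-1 ^+ i.+1) ((- 2^-1) ^+ i.+1) => a b.
  by field; rewrite t0 pnatr_eq0 -lt0n fact_gt0.
apply: cvgMl; apply: cvgB.
  by rewrite (cvg_shiftS (series (exp_coeff (t / 2)))); exact: is_cvg_series_exp_coeff.
by rewrite (cvg_shiftS (series (exp_coeff (- (t / 2))))); exact: is_cvg_series_exp_coeff.
Qed.

(** For small t the two generating functions multiply to 1; the coefficients of their Cauchy product
    are then determined by [power_series_coef_eq0]. *)
Lemma bernoulli_half_conv n :
  \sum_(i < n.+1) (bernoulli_poly R i).[1 / 2] / i`!%:R * sinhc_coef (n - i) =
  (n == 0%N)%:R.
Proof.
pose c i := (bernoulli_poly R i).[1 / 2] / i`!%:R.
pose d n := \sum_(i < n.+1) c i * sinhc_coef (n - i).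
have Hc := bernoulli_polyP (1 / 2 : R); rewrite -/c in Hc.
(* Convergence at a single point t1 gives geometric bounds on the Bernoulli coefficients. *)
near (0 : R)^' => t1.
have t10 : t1 != 0 by near: t1; exact: nbhs_dnbhs_neq.
have t11 : `|t1| < 1 by near: t1; exact: dnbhs0_lt.
have c1 : cvgn (pseries c t1).
  near: t1; apply: filterS Hc => u cu; apply/cvg_ex.
  by exists (u * expR (1 / 2 * u) / (expR u - 1)).
have [M0 HM] := cvg_pseries_coef_bound t10 c1.
pose rho := `|t1|^-1; pose M := `|M0| + 1.
have rho1 : 1 < rho by rewrite /rho invf_gt1 ?normr_gt0.
have rho0 : 0 < rho by lra.
have rho0' := ltW rho0.
have M1 : 1 <= M by rewrite /M lerDr.
have cM k : `|c k| <= M * rho ^+ k.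
  apply: (le_trans (HM k)); rewrite ler_wpM2r ?exprn_ge0//.
  by apply: (le_trans (ler_norm _)); rewrite lerDl.
have sM k : `|sinhc_coef k| <= M * rho ^+ k.
  apply: (le_trans (sinhc_coef_bound k)).
  by rewrite (le_trans M1)// ler_peMr ?exprn_ege1 ?(ltW rho1)// (le_trans ler01).
suff /(_ n)/eqP : forall n, d n - (n == 0%N)%:R = 0 by rewrite subr_eq0 => /eqP.
(* The k + 1 terms of the convolution cost a factor at most 2^k, hence 2 rho; the added 1 covers the
   subtracted indicator. *)
apply: (@power_series_coef_eq0 _ (M ^+ 2 + 1) (2 * rho)).
- by rewrite mulr_gt0.
- move=> k; rewrite (le_trans (ler_normB _ _))// mulrDl mul1r lerD//.
    rewrite /d (le_trans (ler_norm_sum _ _ _))//.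
    apply: (@le_trans _ _ (\sum_(i < k.+1) M ^+ 2 * rho ^+ k)).
      apply: ler_sum => i _; rewrite normrM.
      apply: (le_trans (ler_pM (normr_ge0 _) (normr_ge0 _) (cM i) (sM _))).
      have -> : rho ^+ k = rho ^+ i * rho ^+ (k - i) by rewrite -exprD subnKC// leq_ord.
      by rewrite le_eqVlt; apply/orP; left; apply/eqP; ring.
    rewrite sumr_const card_ord -[leLHS]mulr_natr exprMn -mulrA ler_wpM2l ?exprn_ge0//.
      by lra.
    rewrite mulrC ler_wpM2r ?exprn_ge0// -natrX ler_nat ltn_expl//.
  rewrite ger0_norm// (@le_trans _ _ 1) ?lern1 ?leq_b1//.
  by rewrite exprn_ege1//; lra.
near=> t.
have t0 : t != 0 by near: t; exact: nbhs_dnbhs_neq.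
(* The Cauchy product lemma requires a ratio rho |t| below 1/2. *)
have ht : `|t| < (2 * rho)^-1.
  by near: t; apply: dnbhs0_lt; rewrite invr_gt0 mulr_gt0.
have ct : pseries c t @ \oo --> t * expR (1 / 2 * t) / (expR t - 1) by near: t; exact: Hc.
have r2 : rho * `|t| < 2^-1.
  have : rho * `|t| < rho * (2 * rho)^-1 by rewrite ltr_pM2l.
  by rewrite invfM mulrCA mulfV ?gt_eqF// mulr1.
have bnd (a : nat -> R) : (forall k, `|a k| <= M * rho ^+ k) ->
    forall k, `|a k * t ^+ k| <= M * (rho * `|t|) ^+ k.
  move=> aM k; rewrite normrM normrX exprMn mulrA ler_wpM2r ?exprn_ge0//.
have e0 : expR t - 1 != 0.
  by rewrite subr_eq0 -expR0; apply: contra t0 => /eqP /expR_inj ->.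
have := cauchy_geometric (mulr_ge0 (ltW rho0) (normr_ge0 t)) r2 (bnd _ cM) (bnd _ sM)
  ct (cvg_pseries_sinhc t0).
have -> : t * expR (1 / 2 * t) / (expR t - 1) * ((expR (t / 2) - expR (- (t / 2))) / t) = 1.
  have -> : 1 / 2 * t = t / 2 by rewrite mul1r mulrC.
  have et : expR t = expR (t / 2) * expR (t / 2) by rewrite -expRD; congr expR; lra.
  rewrite expRN; move: e0; rewrite et => e0; field.
  by rewrite t0 e0 gt_eqF ?expR_gt0.
move=> h1.
have h2 : series (fun n => (n == 0%N)%:R : R) @ \oo --> (1 : R).
  rewrite -cvg_shiftS.
  have -> : (fun n => series (fun n => (n == 0%N)%:R : R) n.+1) = fun=> 1.
    by apply/funext => k; rewrite /series/= big_nat_recl//= big1 ?addr0.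
  exact: cvg_cst.
have h3 := cvgB h1 h2; rewrite subrr in h3.
suff -> : pseries (fun i => d i - (i == 0%N)%:R) t =
  (fun k => series (fun i => \sum_(j < i.+1)
                       c j * t ^+ j * (sinhc_coef (i - j) * t ^+ (i - j))) k -
            series (fun i => (i == 0%N)%:R) k) by exact: h3.
apply/funext => k; rewrite /pseries /series /= -sumrB; apply: eq_bigr => i _.
rewrite mulrBl; congr (_ - _); last by case: i => [|i]; rewrite ?expr0 ?mulr1 ?mul0r.
rewrite /d mulr_suml; apply: eq_bigr => j _.
have -> : t ^+ i = t ^+ j * t ^+ (i - j) by rewrite -exprD subnKC// leq_ord.
ring.
Unshelve. all: by end_near. Qed.

End PowerSeries.

(** * Multiple zeta-star values as limits *)

Section SortedTuples.
Implicit Types (n N : nat).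

Fixpoint sorted_seqs n : nat -> seq (seq nat) :=
  if n is n'.+1 then
    fix aux N := if N is N'.+1 then aux N' ++ [seq rcons s N | s <- sorted_seqs n' N] else [::]
  else fun=> [:: [::]].

Lemma sorted_seqsS n N : sorted_seqs n.+1 N.+1 =
  sorted_seqs n.+1 N ++ [seq rcons s N.+1 | s <- sorted_seqs n N.+1].
Proof. by []. Qed.

Lemma mem_sorted_seqs n N s : (s \in sorted_seqs n N) =
  [&& size s == n, sorted leq s & all (fun k => 1 <= k <= N)%N s].
Proof.
elim: n N s => [|n IHn] N s; first by case: s.
elim: N s => [|N IHN] s.
  by case: s => [|[|k] s] //=; rewrite !andbF.
rewrite sorted_seqsS mem_cat IHN; case/lastP: s => [|s k].
  by rewrite /=; apply/negbTE; apply/negP => /mapP[[]].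
rewrite size_rcons eqSS.
have -> : (rcons s k \in [seq rcons s0 N.+1 | s0 <- sorted_seqs n N.+1]) =
    (k == N.+1) && (s \in sorted_seqs n N.+1).
  apply/mapP/andP => [[s' hs' /rcons_inj[-> ->]]//|[/eqP -> hs]]; by exists s.
rewrite IHn !all_rcons.
have sr : sorted leq (rcons s k) = sorted leq s && all (fun j => j <= k)%N s.
  rewrite !sorted_pairwise; [|exact: leq_trans..].
  by rewrite pairwise_rcons andbC; congr (_ && _); apply: eq_all => j.
rewrite sr; have [->|kN] /= := eqVneq k N.+1.
  rewrite ltnn !andbF /=; case: (size s == n) => //=; case: (sorted leq s) => //=.
  by rewrite leqnn /=; rewrite -all_predI; apply: eq_all => j /=; lia.
rewrite orbF; case: (size s == n) => //=; case: (sorted leq s) => //=.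
have -> : (k <= N.+1)%N = (k <= N)%N by rewrite leq_eqVlt (negPf kN).
case: (boolP (all _ s)) => //= /allP h; case: (boolP (1 <= k <= N)%N) => //= hk.
by apply/allP/allP => h' j js; have := h' j js; have := h j js; lia.
Qed.

Lemma uniq_sorted_seqs n N : uniq (sorted_seqs n N).
Proof.
elim: n N => [|n IHn] N//; elim: N => [|N IHN]//.
rewrite sorted_seqsS cat_uniq IHN map_inj_uniq ?IHn ?andbT; last first.
  by move=> s t /rcons_inj[].
apply/hasPn => _ /mapP[s _ ->]; rewrite mem_sorted_seqs all_rcons ltnn.
by rewrite !andbF.
Qed.

(** Sorted sequences enumerate the monomials of h_n; entries start at 1 and variables at 0, hence
    [k.-1]. *)
Lemma sum_sorted_seqs (A : comNzRingType) (x : nat -> A) n N :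
  \sum_(s <- sorted_seqs n N) \prod_(k <- s) x k.-1 = hsym x N n.
Proof.
elim: n N => [|n IHn] N; first by rewrite hsym0 big_seq1 big_nil.
elim: N => [|N IHN]; first by rewrite big_nil.
rewrite sorted_seqsS big_cat hsymS -IHN -IHn big_map mulr_sumr /=; congr (_ + _).
by apply: eq_bigr => s _; rewrite big_rcons mulrC.
Qed.

End SortedTuples.

(** The terms are nonnegative and the tuples bounded by N exhaust all sorted tuples, so the supremum
    over finite sets is the limit of the sums over these boxes. *)
Lemma mzsv_nseq (R : realType) n a (z : R) :
  (fun N => hsym (fun k => k.+1%:R ^- a : R) N n) @ \oo --> z ->
  mzsv R (nseq_tuple n a) = z%:E.
Proof.
set h := fun N => _ => hcvg.
pose F (k : n.-tuple nat) : \bar R :=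
  (\prod_(i < n) (tnth k i)%:R ^- tnth (nseq_tuple n a) i)%:E.
have FE k : F k = (\prod_(j <- k) j%:R ^- a)%:E.
  rewrite /F big_tuple; congr (_%:E); apply: eq_bigr => i _.
  by rewrite tnth_nseq.
have F0 k : (0 <= F k)%E.
  rewrite FE lee_fin; apply: prodr_ge0 => j _; by rewrite invr_ge0 exprn_ge0.
pose T N : seq (n.-tuple nat) := pmap insub (sorted_seqs n N).
have TE N (k : n.-tuple nat) :
    (k \in T N) = sorted leq k && all (fun j => 1 <= j <= N)%N k.
  by rewrite mem_pmap_sub mem_sorted_seqs size_tuple eqxx.
have uT N : uniq (T N) by rewrite pmap_sub_uniq// uniq_sorted_seqs.
have sumT N : (\sum_(k <- T N) F k)%E = (h N)%:E.
  under eq_bigr do rewrite FE.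
  rewrite sumEFin; congr (_%:E); rewrite /h -sum_sorted_seqs.
  have -> : \sum_(k <- T N) \prod_(j <- k) j%:R ^- a =
    \sum_(s <- map val (T N)) \prod_(j <- s) j%:R ^- a :> R by rewrite big_map.
  rewrite pmap_filter; last exact: insubK.
  have -> : [seq s <- sorted_seqs n N | isSome (insub s : option (n.-tuple nat))] =
      sorted_seqs n N.
    apply/all_filterP/allP => s; rewrite mem_sorted_seqs => /and3P[hs _ _] /=.
    by rewrite insubT.
  apply: eq_big_seq => s; rewrite mem_sorted_seqs => /and3P[_ _ /allP hs].
  by apply: eq_big_seq => j /hs /andP[j0 _]; rewrite prednK.
have h0 N p : 0 <= hsym (fun k => k.+1%:R ^- a : R) N p.
  elim: N p => [|N IHN] p /=; first exact: ler0n.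
  by apply: sumr_ge0 => i _; rewrite mulr_ge0 ?exprn_ge0 ?invr_ge0 ?exprn_ge0.
have hz N : h N <= z.
  rewrite -(cvg_lim _ hcvg)//; apply: nondecreasing_cvgn_le; last by apply/cvg_ex; exists z.
  apply/nondecreasing_seqP => k; rewrite /h /= big_ord_recl expr0 mul1r subn0 lerDl.
  by apply: sumr_ge0 => i _; rewrite mulr_ge0 ?exprn_ge0 ?invr_ge0 ?exprn_ge0.
have ub : (mzsv R (nseq_tuple n a) <= z%:E)%E.
  apply: ge_ereal_sup => _ [A [/finite_seqP [s ->] sS] <-].
  (* The largest entry of any tuple in the finite set, which thus lies in the box of N. *)
  pose N := \max_(k <- s) \max_(j <- (k : n.-tuple nat)) j.
  have sT : [set` s] `<=` [set` T N].
    move=> k ks; have := sS _ ks; rewrite /= TE => /andP[-> /allP k1] /=.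
    apply/allP => j jk; rewrite (k1 _ jk) /=.
    apply: (@leq_trans (\max_(j <- k) j)); first exact: (@leq_bigmax_seq _ _ xpredT id).
    exact: (@leq_bigmax_seq _ _ xpredT (fun k : n.-tuple nat => \max_(j <- k) j)).
  apply: (@le_trans _ _ (h N)%:E); last by rewrite lee_fin.
  rewrite -sumT (fsbig_seq _ F (uT N)).
  apply: lee_fsum_nneg_subset; [exact: finite_seq|exact: finite_seq| |].
    by move=> k /[!inE]; exact: sT.
  by move=> k _; exact: F0.
have lb N : ((h N)%:E <= mzsv R (nseq_tuple n a))%E.
  apply: esum_ge; exists [set` T N]; last by rewrite -sumT fsbig_seq.
  split; first exact: finite_seq.
  move=> k /=; rewrite TE => /andP[-> /allP kN] /=.
  by apply/allP => j /kN /andP[].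
have : mzsv R (nseq_tuple n a) \is a fin_num.
  by rewrite fin_numElt (lt_le_trans (ltNyr _) (lb 0%N)) (le_lt_trans ub (ltry _)).
move=> /fineK E; apply/eqP; rewrite eq_le ub -E lee_fin.
apply: (cvgr_to_le hcvg); apply: nearW => N.
by rewrite -lee_fin E.
Qed.

(** * Passage to the limit *)

Section Limits.
Variable R : realType.

(** As e_0 = 1, the relation H(X) E(-X) = 1 expresses h_p through lower h_i and the e_i; the limits
    solve the same triangular recursion. *)
Lemma cvg_hsym (x a b : nat -> R) :
  (forall i, (fun N => esym (fun k => - x k) N i) @ \oo --> a i) -> a 0%N = 1 ->
  (forall p, \sum_(i < p.+1) b i * a (p - i)%N = (p == 0%N)%:R) ->
  forall p, (fun N => hsym x N p) @ \oo --> b p.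
Proof.
move=> ha a0 hb; elim/ltn_ind => p IH.
have -> : (fun N => hsym x N p) = (fun N => (p == 0%N)%:R -
    \sum_(i < p) hsym x N i * esym (fun k => - x k) N (p - i)).
  apply/funext => N; rewrite -(sum_esymN_hsym x N p) big_ord_recr /= subnn esym0 mulr1.
  by rewrite [RHS]addrAC subrr add0r.
have -> : b p = (p == 0%N)%:R - \sum_(i < p) b i * a (p - i)%N.
  by rewrite -(hb p) big_ord_recr /= subnn a0 mulr1 [RHS]addrAC subrr add0r.
apply: cvgB; first exact: cvg_cst.
apply: cvg_big => [|i _]; first exact: add_continuous.
by apply: cvgM; [exact: IH | exact: ha].
Qed.

Let c i : R := (bernoulli_poly R i).[1 / 2] / i`!%:R.

(** In degree 2p an odd index i leaves 2p - i odd, where the even function sinh(t/2) / (t/2) has no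
    coefficient. *)
Lemma bernoulli_half_even_conv p :
  \sum_(i < p.+1) c (2 * i) * (2^-1 ^+ (2 * (p - i)) / ((2 * (p - i)).+1)`!%:R) =
  (p == 0%N)%:R.
Proof.
have split2 (s : nat -> R) q : \sum_(k < (2 * q).+1) s k =
    \sum_(j < q.+1) s (2 * j)%N + \sum_(j < q) s (2 * j).+1.
  elim: q => [|q IH]; first by rewrite muln0 !big_ord_recr !big_ord0 /=; ring.
  rewrite mulnS add2n big_ord_recr big_ord_recr /= IH [in RHS]big_ord_recr /=.
  by rewrite [X in _ = _ + X]big_ord_recr /= mulnS add2n; ring.
have := bernoulli_half_conv R (2 * p); rewrite muln_eq0 /= => <-.
rewrite (split2 (fun i => c i * sinhc_coef R (2 * p - i))).
rewrite [X in _ = _ + X]big1 ?addr0 => [|[j jp] _].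
  apply: eq_bigr => -[i ip] _; rewrite -mulnBr /sinhc_coef; congr (_ * (_ / _)).
  by rewrite exprNn -signr_odd /= oddM /= expr1 exprS; lra.
rewrite /sinhc_coef exprNn -signr_odd.
have -> : odd (2 * p - (2 * j).+1).+1 = false by rewrite /= oddB; lia.
by rewrite expr0 mul1r subrr mul0r mulr0.
Qed.

Lemma cvg_hsym_inv_sq p :
  (fun N => hsym (@inv_sq R) N p) @ \oo --> (-1) ^+ p * (2 * pi) ^+ (2 * p) * c (2 * p).
Proof.
pose a i : R := (-1) ^+ i * (pi ^+ i.*2 / (i.*2.+1)`!%:R).
apply: (@cvg_hsym _ a (fun p => (-1) ^+ p * (2 * pi) ^+ (2 * p) * c (2 * p))) => [i||q].
- have -> : (fun N => esym (fun k => - inv_sq R k) N i) =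
      (fun N => (-1) ^+ i * esym (@inv_sq R) N i).
    apply/funext => N; rewrite -esymZ; congr (esym _ N i).
    by apply/funext => k; rewrite mulN1r.
  by apply: cvgMr; exact: cvg_esym_inv_sq.
- by rewrite /a !expr0 mul1r divr1.
(* Substituting 2 pi i t for t multiplies the degree 2q identity by (2 pi i)^(2q), which is 1 when q
   = 0. *)
transitivity ((-1) ^+ q * (2 * pi) ^+ (2 * q) * (q == 0%N)%:R : R); last first.
  by case: q => [|q]; rewrite ?mulr0// muln0 !expr0 !mul1r.
rewrite -bernoulli_half_even_conv mulr_sumr; apply: eq_bigr => -[i iq] _ /=.
rewrite /a -mul2n; set d := (q - i)%N; have -> : q = (i + d)%N by rewrite subnKC.
rewrite mulnDr [(-1) ^+ (i + d)]exprD [(2 * pi) ^+ (2 * i + 2 * d)]exprD; set u := (_`!%:R)^-1.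
have -> : pi ^+ (2 * d) = (2 * pi) ^+ (2 * d) * 2^-1 ^+ (2 * d) :> R.
  by rewrite -exprMn; congr (_ ^+ _); field.
ring.
Qed.

End Limits.

(** * Roots of unity as complex exponentials *)

Section RootOfUnity.
Variable R : realType.

Lemma prim_root_cis m : (0 < m)%N -> m.-primitive_root (cis (2 * pi / m%:R : R)).
Proof.
move=> m0; have p0 := pi_gt0 R.
have m0' : 0 < m%:R :> R by rewrite ltr0n.
apply/andP; split => //; apply/forallP => -[i im] /=.
rewrite unity_rootE moivre /cis.
have [->|ne] := eqVneq i.+1 m.
  by rewrite [m%:R * _]mulrC divfK ?(gt_eqF m0')// mulr_natl cos2pi sin2pi eqxx.
have {im ne}im : (i.+1 < m)%N by rewrite ltn_neqAle ne.
(* The real part cos 2t = 1 - 2 sin^2 t is below 1, because 0 < t < pi. *)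
rewrite eqbF_neg eq_complex /= negb_and; apply/orP; left.
set t := i.+1%:R * pi / m%:R : R.
have -> : i.+1%:R * (2 * pi / m%:R) = t *+ 2 by rewrite /t mulr2n; field; rewrite gt_eqF.
have st : 0 < sin t.
  apply: sin_gt0_pi; rewrite /t divr_gt0 ?mulr_gt0//= ltr_pdivrMr// mulrC ltr_pM2l//.
  by rewrite ltr_nat.
have := cos2Dsin2 t; rewrite cos_mulr2n => h; apply/eqP => h'.
have : 0 < sin t ^+ 2 by rewrite exprn_gt0.
by move: h'; rewrite mulr2n; lra.
Qed.

Lemma cexp_cis m (q : nat) :
  cexp ((2 * pi)%:C%C * 'i%C / m%:R * q%:R) = cis (2 * pi / m%:R : R) ^+ q.
Proof.
rewrite moivre.
have -> : (2 * pi)%:C%C * 'i%C / m%:R * q%:R = (0 +i* (q%:R * (2 * pi / m%:R)))%C :> R[i].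
  rewrite -!(rmorph_nat (real_complex R)) -fmorphV.
  by apply/eqP; rewrite eq_complex /=; apply/andP; split; apply/eqP; ring.
by rewrite /cexp expR0 !mul1r.
Qed.

End RootOfUnity.

(** Separates real and imaginary parts, so that all limits are taken in R. *)
Lemma sum_real_complexM (R : rcfType) (J : finType) (P : pred J) (u : J -> R) (v : J -> R[i]) :
  \sum_(i | P i) (u i)%:C%C * v i =
  ((\sum_(i | P i) u i * complex.Re (v i)) +i* (\sum_(i | P i) u i * complex.Im (v i)))%C.
Proof.
elim: (index_enum J) => [|i r IH]; first by rewrite !big_nil.
rewrite !big_cons IH; case: (P i) => //.
move: (\sum_(j <- r | P j) _) (\sum_(j <- r | P j) _) => a b.
by apply/eqP; rewrite eq_complex; case: (v i) => x y /=; apply/andP; split; apply/eqP; ring.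
Qed.

(* zeta-star converges, and its value is given by the formula.  A tuple
   (p_1, ..., p_m) with sum m * n is a function 'I_m -> {0, ..., m * n}; the
   index l : 'I_m stands for ell - 1. *)
Theorem theorem3 (R : realType) (m n : nat)
    (m_gt0 : (0 < m)%N) (n_gt0 : (0 < n)%N) (m_even : ~~ odd m) :
  let zeta_star := mzsv R (nseq_tuple n (2 * m)%N) in
  zeta_star \is a fin_num /\
  (fine zeta_star)%:C%C =
    (2 * pi)%:C%C ^+ (2 * m * n) *
    \sum_(p : {ffun 'I_m -> 'I_(m * n).+1} | (\sum_(j < m) p j == m * n)%N)
      (\prod_(j < m)
         ((bernoulli_poly R (2 * p j)).[1 / 2] / (2 * p j)`!%:R)%:C%C) *
      cexp ((2 * pi)%:C%C * 'i%C / m%:R * \sum_(l < m) (l * p l)%:R).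
Proof.
pose w := cis (2 * pi / m%:R : R).
pose I (p : {ffun 'I_m -> 'I_(m * n).+1}) := (\sum_(j < m) p j == m * n)%N.
pose e (p : {ffun 'I_m -> 'I_(m * n).+1}) := w ^+ (\sum_(j < m) j * p j).
pose b p : R := (-1) ^+ p * (2 * pi) ^+ (2 * p) *
  ((bernoulli_poly R (2 * p)).[1 / 2] / (2 * p)`!%:R).
have H N : (hsym (fun k => k.+1%:R ^- (2 * m)) N n)%:C%C =
    \sum_(p | I p) (\prod_(j < m) hsym (@inv_sq R) N (p j))%:C%C * e p.
  rewrite rmorph_hsym.
  have -> : real_complex R \o (fun k => k.+1%:R ^- (2 * m)) = fun k => (inv_sq R k)%:C%C ^+ m.
    by apply/funext => k; rewrite /= -(rmorphXn (real_complex R)) /inv_sq -exprVn exprM.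
  rewrite (prod_hsym_prim_root _ _ _ (prim_root_cis R m_gt0)); apply: eq_bigr => p _.
  rewrite rmorph_prod; congr (_ * _); apply: eq_bigr => j _.
  by rewrite rmorph_hsym.
have ReH N : hsym (fun k => k.+1%:R ^- (2 * m)) N n =
    \sum_(p | I p) (\prod_(j < m) hsym (@inv_sq R) N (p j)) * complex.Re (e p).
  by have := H N; rewrite sum_real_complexM => -[].
(* The left side of [H] is real, so this holds for each N and passes to the limit in [Im0]. *)
have ImH N : \sum_(p | I p) (\prod_(j < m) hsym (@inv_sq R) N (p j)) * complex.Im (e p) = 0.
  by have := H N; rewrite sum_real_complexM => -[].
have cvgH (u : {ffun 'I_m -> 'I_(m * n).+1} -> R) :
    (fun N => \sum_(p | I p) (\prod_(j < m) hsym (@inv_sq R) N (p j)) * u p) @ \oo -->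
    \sum_(p | I p) (\prod_(j < m) b (p j)) * u p.
  apply: cvg_big => [|p _]; first exact: add_continuous.
  apply: cvgMl; apply: cvg_big => [|j _]; first exact: mul_continuous.
  exact: cvg_hsym_inv_sq.
have Im0 : \sum_(p | I p) (\prod_(j < m) b (p j)) * complex.Im (e p) = 0.
  apply: (cvg_unique _ (cvgH _)); first exact: norm_hausdorff.
  by rewrite (funext ImH); exact: cvg_cst.
have zE : mzsv R (nseq_tuple n (2 * m)%N) =
    (\sum_(p | I p) (\prod_(j < m) b (p j)) * complex.Re (e p))%:E.
  by apply: mzsv_nseq; rewrite (funext ReH); exact: cvgH.
move=> zeta_star; rewrite /zeta_star zE; split => //=.
transitivity (\sum_(p | I p) (\prod_(j < m) b (p j))%:C%C * e p).
  by rewrite sum_real_complexM Im0.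
rewrite mulr_sumr; apply: eq_bigr => p /eqP sp.
rewrite -natr_sum cexp_cis mulrA; congr (_ * _).
rewrite -!rmorph_prod -rmorphXn -rmorphM /=; congr (_%:C%C).
(* The p_j sum to m n, so the powers collect into (2 pi)^(2mn) and the signs into (-1)^(mn) = 1. *)
rewrite /b !big_split /= -!expr_sum -big_distrr /= sp -signr_odd oddM (negPf m_even).
by rewrite expr0 !mul1r mulnA.
Qed.
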